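(* Let $u=u_1\cdots u_r$ be an allowed word of $\Sigma_A$ of length $r\ge2$, and let $$f_u(z)=\tilde\tau_u(z)\det(\mathbf I-zP)+z^{r-1}\delta_u\big(\operatorname{adj}(\mathbf I-zP)\big)_{u_ru_1}.$$ Let $z_0$ be the smallest positive real root of $f_u$. Then $\rho(C_u)=\ln z_0$.
   Context: Let $\Sigma=\{1,\dots,N\}$, $A$ an irreducible $N\times N$ $0$–$1$ matrix, $\Sigma_A=\{x\in\Sigma^{\mathbb N}:A_{x_nx_{n+1}}=1\ \forall n\}$ with left shift $\sigma$. A word is allowed if it occurs in some element of $\Sigma_A$; $C_u$ is the set of $x\in\Sigma_A$ beginning with $u$. $P$ is a row-stochastic matrix with $P_{ij}>0$ iff $A_{ij}=1$, $\mathbf p$ its stationary vector, $\mu=\mu_P$ the Markov measure $\mu(C_w)=p_{w_1}P_{w_1w_2}\cdots P_{w_{n-1}w_n}$. For a hole $H$, $\mathcal W_m=\{x:\sigma^ix\notin H,0\le i\le m\}$, $\rho(H)=-\lim_m\frac1m\ln\mu(\mathcal W_m)$. $\operatorname{adj}$ is the adjugate matrix. $\delta_u=P_{u_1u_2}\cdots P_{u_{r-1}u_r}$. Weighted autocorrelation: for $0\le s\le r-1$, $c_{s,u,u}=1$ if $u_{s+1}\cdots u_r=u_1\cdots u_{r-s}$ and $0$ otherwise; $\delta_{s,u,u}=\prod_{j=r-s}^{r-1}P_{u_ju_{j+1}}$ (empty product $=1$); $\tau_u(z)=\sum_{s=0}^{r-1}c_{s,u,u}\delta_{s,u,u}z^{s}$;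 and $\tilde\tau_u(z)=\tau_u(z)-z^{r-1}c_{r-1,u,u}\delta_u$. *)

(* Defs.v *)
From HB Require Import structures.
From mathcomp Require Import all_boot all_order all_algebra.
From mathcomp Require Import all_classical all_reals all_analysis.
Set Implicit Arguments. Unset Strict Implicit. Unset Printing Implicit Defensive.
Import Order.TTheory GRing.Theory Num.Theory.
Local Open Scope ring_scope.

Section Defs.
Variable N : nat.

Definition irreducible01 (A : 'M[bool]_N) : Prop :=
  forall i j : 'I_N, exists s : seq 'I_N,
    s != [::] /\ path (fun a b => A a b) i s /\ last i s = j.

Definition allowed (A : 'M[bool]_N) (u : seq 'I_N) : Prop :=
  exists x : nat -> 'I_N, (forall n, A (x n) (x n.+1)) /\
    exists k : nat, forall i : nat, (i < size u)%N -> x (k + i)%N = nth (x k) u i.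

Variable R : realType.

Fixpoint chain_w (P : 'M[R]_N) (a : 'I_N) (s : seq 'I_N) : R :=
  match s with [::] => 1 | b :: t => P a b * chain_w P b t end.

Definition delta (P : 'M[R]_N) (w : seq 'I_N) : R :=
  match w with [::] => 1 | a :: t => chain_w P a t end.

(* Markov measure of the cylinder C_w (C_[::] is the whole space) *)
Definition muC (p : 'I_N -> R) (P : 'M[R]_N) (w : seq 'I_N) : R :=
  match w with [::] => 1 | a :: t => p a * chain_w P a t end.

(* mu(W_m) for the hole C_u, |u| = r: W_m = {x : sigma^i x \notin C_u, 0<=i<=m}
   is the disjoint union of the cylinders C_w, |w| = m + r, such that u does not
   occur in w at positions 0..m *)
Definition muW (p : 'I_N -> R) (P : 'M[R]_N) (u : seq 'I_N) (m : nat) : R :=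
  \sum_(w : (m + size u).-tuple 'I_N |
          [forall i : 'I_m.+1, take (size u) (drop i w) != u]) muC p P w.

Definition c_auto (u : seq 'I_N) (s : nat) : R :=
  if drop s u == take (size u - s)%N u then 1 else 0.
Definition delta_auto (P : 'M[R]_N) (u : seq 'I_N) (s : nat) : R :=
  (* prod_{j=r-s}^{r-1} P_{u_j u_{j+1}} (1-indexed) = delta of last s+1 letters *)
  delta P (drop (size u - s - 1)%N u).
Definition tau (P : 'M[R]_N) (u : seq 'I_N) (z : R) : R :=
  \sum_(0 <= s < size u) c_auto u s * delta_auto P u s * z ^+ s.
Definition tau_tilde (P : 'M[R]_N) (u : seq 'I_N) (z : R) : R :=
  tau P u z - z ^+ (size u).-1 * c_auto u (size u).-1 * delta P u.

Definition f_u (P : 'M[R]_N) (u : seq 'I_N) (z : R) : R :=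
  match u with
  | [::] => 0
  | a :: _ =>
    tau_tilde P u z * \det (1%:M - z *: P)
    + z ^+ (size u).-1 * delta P u * (\adj (1%:M - z *: P)) (last a u) a
  end.
End Defs.

(* Main.v *)
Require Import Defs.
From HB Require Import structures.
From mathcomp Require Import all_boot all_order all_algebra.
From mathcomp Require Import all_classical all_reals all_analysis.
From mathcomp Require Import zify ring lra.
Set Implicit Arguments. Unset Strict Implicit. Unset Printing Implicit Defensive.
Import Order.TTheory GRing.Theory Num.Theory.
Import numFieldNormedType.Exports.
Local Open Scope classical_set_scope.
Local Open Scope ring_scope.

(* Let [s_n(i)] be the probability that a path of [n] steps from [i] avoids [u],
   and [t_n] the sum of the [s_n(i)], which is submultiplicative; up to positive
   constants, [muW p P u m] is [t_(m + r - 1)].  The polynomial [f_u] is the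
   determinant of the bordered matrix
     [[ I - zP, - e_(u_1) ], [ z^(r-1) delta_u e_(u_r)^T, tau_tilde ]].
   If [(y, c)] solves the bordered system with right-hand side [(kappa 1, 0)],
   then stopping at the first occurrence of [u] together with the
   autocorrelation identity shows [y_i = kappa sum_n s_n(i) z^n] whenever
   [t_n z^n] tends to [0].  With [kappa = 0] the matrix is invertible for such
   [z], so [t_n z0^n >= 1] for all [n >= 1].  With [kappa = f_u(z)] Cramer's rule
   bounds the survival series near the end point of the decay region unless
   [f_u] vanishes there, while that series diverges at the end point; hence the
   decay region is exactly [z < z0], and [t_n] decays like [z0^(-n)]. *)

(** * Weighted sums over words *)

Lemma sum_tuple_cons (R : nmodType) (I : finType) k (F : seq I -> R) :
  \sum_(w : k.+1.-tuple I) F w = \sum_i \sum_(t : k.-tuple I) F (i :: t).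
Proof.
rewrite pair_big /=.
rewrite (reindex (fun it : I * k.-tuple I => [tuple of it.1 :: it.2])) /=.
  by apply: eq_bigr => -[].
exists (fun t : k.+1.-tuple I => (thead t, [tuple of behead t])).
  by case=> j t _ /=; congr (_, _); apply: val_inj.
by move=> t _ /=; apply: val_inj => /=; rewrite {3}(tuple_eta t).
Qed.


Section WordSums.
Variables (R : realType) (N : nat) (P : 'M[R]_N).
Implicit Types (i j : 'I_N) (t u : seq 'I_N) (F G : seq 'I_N -> R).

(** Recursion on the first step replaces sums over tuples of fixed length; [wsum_tuple] links the
    two. The start [i] is not part of the word passed to [F]. *)
Fixpoint wsum (n : nat) i F : R :=
  if n is n'.+1 then \sum_j P i j * wsum n' j (fun t => F (j :: t)) else F [::].

Lemma eq_wsum n i F G : (forall t, size t = n -> F t = G t) ->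
  wsum n i F = wsum n i G.
Proof.
elim: n i F G => [|n IH] i F G FG /=; first exact: FG.
by apply: eq_bigr => j _; congr (_ * _); apply: IH => t st; apply: FG; rewrite /= st.
Qed.

(** The Markov property at time [n]: the weight of the continuation depends on the past only through
    [last i t]. *)
Lemma wsum_cat n m i F :
  wsum (n + m) i F = wsum n i (fun t => wsum m (last i t) (fun v => F (t ++ v))).
Proof. by elim: n i F => [|n IH] i F //=; apply: eq_bigr => j _; rewrite IH. Qed.

Lemma wsumD n i F G : wsum n i (fun t => F t + G t) = wsum n i F + wsum n i G.
Proof.
elim: n i F G => [|n IH] i F G //=.
by rewrite -big_split; apply: eq_bigr => j _; rewrite IH mulrDr.
Qed.

Lemma wsumZ n i (c : R) F : wsum n i (fun t => c * F t) = c * wsum n i F.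
Proof.
elim: n i F => [|n IH] i F //=.
by rewrite mulr_sumr; apply: eq_bigr => j _; rewrite IH mulrCA.
Qed.

Lemma wsum_sum (I : Type) (r : seq I) (Q : pred I) n i (F : I -> seq 'I_N -> R) :
  wsum n i (fun t => \sum_(k <- r | Q k) F k t) =
  \sum_(k <- r | Q k) wsum n i (F k).
Proof.
elim: n i F => [|n IH] i F //=; rewrite exchange_big /=.
by apply: eq_bigr => j _; rewrite IH mulr_sumr.
Qed.

Lemma wsum_pred1 i v : wsum (size v) i (fun t => (t == v)%:R) = chain_w P i v.
Proof.
elim: v i => [|a v IH] i //=.
rewrite (bigD1 a) //= big1 ?addr0 => [|j /negbTE ja].
  by rewrite -IH; congr (_ * _); apply: eq_wsum => t _; rewrite eqseq_cons eqxx.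
rewrite (@eq_wsum _ _ _ (fun t => 0 * 0)); first by rewrite wsumZ mul0r mulr0.
by move=> t _; rewrite eqseq_cons ja mul0r.
Qed.

Lemma wsum_tuple n i F :
  wsum n i F = \sum_(t : n.-tuple 'I_N) chain_w P i t * F t.
Proof.
elim: n i F => [|n IH] i F /=.
  rewrite (big_pred1 [tuple]) ?mul1r // => t.
  by rewrite [t]tuple0 /= eqxx.
rewrite (sum_tuple_cons _ (fun t => chain_w P i t * F t)).
apply: eq_bigr => j _; rewrite IH mulr_sumr.
by apply: eq_bigr => t _; rewrite mulrA.
Qed.

Hypothesis P_ge0 : forall i j, 0 <= P i j.

Lemma le_wsum n i F G : (forall t, size t = n -> F t <= G t) ->
  wsum n i F <= wsum n i G.
Proof.
elim: n i F G => [|n IH] i F G FG /=; first exact: FG.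
apply: ler_sum => j _; apply: ler_wpM2l => //.
by apply: IH => t st; apply: FG; rewrite /= st.
Qed.

Lemma wsum_ge0 n i F : (forall t, 0 <= F t) -> 0 <= wsum n i F.
Proof.
move=> F0; rewrite -(mul0r (wsum n i F)) -wsumZ; apply: le_wsum => t _.
by rewrite mul0r.
Qed.

End WordSums.

(** * Words avoiding [u] and its first occurrences *)

Section Avoidance.
Variables (R : realType) (N : nat) (P : 'M[R]_N) (u : seq 'I_N).
Implicit Types (i j : 'I_N) (t w : seq 'I_N) (h y : 'I_N -> R).

Definition avoids w := ~~ infix u w.

(** The start [i] counts as a letter, so [n] steps give a word of [n + 1] letters. The end weight
    [h] covers both the constant 1 and the indicator of the first letter of [u]. *)
Definition survival n i h : R :=
  wsum P n i (fun t => (avoids (i :: t))%:R * h (last i t)).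

(* Erasing the last letter can only destroy an occurrence of [u], so the summand
   is the indicator that [u] is completed for the first time at step [n]. *)
Definition first_hit n i : R :=
  wsum P n i (fun t => (avoids (belast i t))%:R - (avoids (i :: t))%:R).

Definition survival_mass n : R := \sum_i survival n i (fun _ => 1).

Lemma avoids_catl w1 w2 : avoids (w1 ++ w2) -> avoids w1.
Proof. by apply: contra => h; exact: infix_catr. Qed.

Lemma avoids_catr w1 w2 : avoids (w1 ++ w2) -> avoids w2.
Proof. by apply: contra => h; exact: infix_catl. Qed.

Lemma avoids_short w : (size w < size u)%N -> avoids w.
Proof. by move=> h; apply/negP => /size_infix; rewrite leqNgt h. Qed.

(** An occurrence of [u] followed by at least one more letter would already lie in [w]. *)
Lemma avoids_suffix w a : avoids w -> ~~ avoids (rcons w a) ->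
  exists w', rcons w a = w' ++ u.
Proof.
move=> av; rewrite negbK => /infixP [v [s]].
elim/last_ind: s => [|s b _]; first by rewrite cats0 => ->; exists v.
rewrite -!rcons_cat => /rcons_inj [e _].
by move: av; rewrite e /avoids infix_infix.
Qed.

Hypothesis u2 : (2 <= size u)%N.

Lemma survival0 i h : survival 0 i h = h i.
Proof. by rewrite /survival /= avoids_short // mul1r. Qed.

Lemma survivalD n i h h' :
  survival n i (fun j => h j + h' j) = survival n i h + survival n i h'.
Proof. by rewrite -wsumD; apply: eq_wsum => t _; rewrite mulrDr. Qed.

Lemma survivalZ n i c h : survival n i (fun j => c * h j) = c * survival n i h.
Proof. by rewrite -wsumZ; apply: eq_wsum => t _; rewrite mulrCA. Qed.

Lemma first_hit_lt n i : (n.+1 < size u)%N -> first_hit n i = 0.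
Proof.
move=> nu; rewrite /first_hit (@eq_wsum _ _ _ _ _ _ (fun t => 0 * 0)).
  by rewrite wsumZ mul0r.
move=> t st; rewrite !avoids_short ?subrr ?mul0r //= ?size_belast st //; lia.
Qed.

(** The weight vanishes except on words ending in their first occurrence of [u], so only the values
    of [F] on those words matter. *)
Lemma first_hit_val n i (F : seq 'I_N -> R) a :
  (forall t, size t = n -> (exists w', i :: t = w' ++ u) -> F t = a) ->
  wsum P n i (fun t => ((avoids (belast i t))%:R - (avoids (i :: t))%:R) * F t) =
  first_hit n i * a.
Proof.
move=> Fa; rewrite mulrC /first_hit -wsumZ; apply: eq_wsum => t st.
rewrite mulrC; case: (boolP (avoids (i :: t))) => av.
  have -> : avoids (belast i t).
    by move: av; rewrite lastI -cats1; apply: avoids_catl.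
  by rewrite subrr !mulr0.
case: (boolP (avoids (belast i t))) => [av'|]; last by rewrite subrr !mulr0.
congr (_ * _); apply: Fa => //; move: av; rewrite lastI => av.
exact: avoids_suffix.
Qed.

(** An avoiding path extended by one step either still avoids [u] or completes it for the first
    time, and then it stands at the last letter of [u]. *)
Lemma survivalS n i y :
  survival n i (fun j => \sum_k P j k * y k) =
  survival n.+1 i y + first_hit n.+1 i * y (last i u).
Proof.
rewrite -(@first_hit_val _ _ (fun t => y (last i t))); last first.
  move=> t _ [w' e]; rewrite -[last i t]/(last i (i :: t)) e last_cat.
  by case: (u) u2.
rewrite /survival -wsumD -addn1 wsum_cat; apply: eq_wsum => t _ /=.
rewrite mulr_sumr; apply: eq_bigr => k _.
by rewrite cats1 belast_rcons last_rcons; ring.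
Qed.

(* Optional stopping at the first occurrence of [u]. *)
Lemma optional_stopping z y h n i :
  (forall j, y j = z * (\sum_k P j k * y k) + h j) ->
  y i = \sum_(k < n) z ^+ k * survival k i h +
        (\sum_(k < n) z ^+ k.+1 * first_hit k.+1 i) * y (last i u) +
        z ^+ n * survival n i y.
Proof.
move=> yE; elim: n => [|n IH].
  by rewrite !big_ord0 mul0r !add0r mul1r survival0.
rewrite {1}IH !big_ord_recr /=.
have -> : survival n i y =
    z * survival n i (fun j => \sum_k P j k * y k) + survival n i h.
  rewrite -survivalZ -survivalD; apply: eq_wsum => t _; congr (_ * _).
  exact: yE.
by rewrite survivalS exprS; ring.
Qed.

(* A word avoiding [u], ending in its first letter and continued by the rest of
   [u], meets [u] for the first time within the continuation, with [s] letters
   left; telescoping over [s] selects that time. *)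
Lemma survival_autocorrelation n i a v : u = a :: v ->
  delta P u * survival n i (fun j => (j == a)%:R) =
  \sum_(s < (size u).-1)
    c_auto R u s * delta_auto P u s * first_hit (n + (size u).-1 - s) i.
Proof.
move=> uE; have su : (size u).-1 = size v by rewrite uE.
have dE : delta P u = chain_w P a v by rewrite uE.
(* The letter at position [n] is shared: it ends the avoiding prefix and begins the copy of [u]. *)
pose F t := (avoids (take n.+1 (i :: t)))%:R * (drop n (i :: t) == u)%:R : R.
transitivity (wsum P (n + size v) i F).
  rewrite wsum_cat /survival -wsumZ; apply: eq_wsum => t st.
  rewrite dE.
  have [la|la] := eqVneq (last i t) a; last first.
    rewrite !mulr0; apply/esym.
    rewrite (@eq_wsum _ _ _ _ _ _ (fun t => 0 * 0)); first by rewrite wsumZ mul0r.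
    move=> t' _; rewrite /F -cat_cons lastI cat_rcons drop_size_cat ?size_belast //.
    by rewrite uE eqseq_cons (negbTE la) mulr0 mul0r.
  rewrite mulr1 la mulrC -wsum_pred1 -wsumZ; apply: eq_wsum => t' _.
  rewrite /F -cat_cons take_size_cat /= ?st //.
  rewrite -cat_cons lastI cat_rcons drop_size_cat ?size_belast //.
  by rewrite uE eqseq_cons la eqxx.
rewrite su.
transitivity (wsum P (n + size v) i (fun t => \sum_(s < size v)
   ((avoids (take (n + size v - s) (i :: t)))%:R -
    (avoids (take (n + size v - s).+1 (i :: t)))%:R) *
   (drop n (i :: t) == u)%:R)).
  apply: eq_wsum => t st; rewrite -mulr_suml /F.
  have [du|_] := eqVneq (drop n (i :: t)) u; last by rewrite !mulr0.
  congr (_ * _).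
  (* [g s] tests the word without its last [s] letters: [g 0] is 0 because the whole word ends in
     [u], and [g (size v)] is the factor in [F]. *)
  pose g s : R := (avoids (take (n + size v - s).+1 (i :: t)))%:R.
  rewrite (eq_bigr (fun s : 'I_(size v) => g s.+1 - g s)); last first.
    move=> s _; rewrite /g; have sv := ltn_ord s.
    by have -> : (n + size v - s = (n + size v - s.+1).+1)%N by lia.
  rewrite -(big_mkord xpredT (fun s => g s.+1 - g s)) telescope_sumr // /g.
  rewrite addnK subn0 (@take_oversize _ (n + size v).+1) /= ?st //.
  have -> : avoids (i :: t) = false.
    by rewrite /avoids -(cat_take_drop n (i :: t)) du infix_catl ?infix_refl.
  by rewrite mulr0n subr0.
rewrite wsum_sum; apply: eq_bigr => s _; have sv := ltn_ord s.
have -> : (n + size v = (n + size v - s) + s)%N by lia.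
rewrite wsum_cat addnK mulrC.
rewrite -(@first_hit_val _ _ (fun t => wsum P s (last i t)
  (fun t' => (drop n (i :: t ++ t') == u)%:R))).
  apply: eq_wsum => t st; rewrite -wsumZ; apply: eq_wsum => t' _; congr (_ * _).
  rewrite -[take _.+1 _]/(i :: take _ _) take_size_cat //; congr (_%:R - _).
  by rewrite -cat_cons lastI cat_rcons take_size_cat // size_belast st.
move=> t st [w' e].
have sw : (size w' + s = n)%N.
  by have := congr1 size e; rewrite /= size_cat uE /= st; lia.
have su' : size u = (size v).+1 by rewrite uE.
rewrite (@eq_wsum _ _ _ _ _ _
   (fun t' => c_auto R u s * (t' == drop (size u - s) u)%:R)); last first.
  move=> t' _; rewrite -cat_cons e -catA drop_cat ltnNge -sw leq_addr /= addKn.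
  rewrite drop_cat su' leqW // -su'.
  (* Two copies of [u] shifted against each other: the overlap yields [c_auto], and the [s] letters
     still to come are forced. *)
  have -> : (drop s u ++ t' == u) =
      (drop s u == take (size u - s) u) && (t' == drop (size u - s) u).
    rewrite -[X in _ ++ _ == X](cat_take_drop (size u - s) u) eqseq_cat //.
    by rewrite size_drop size_takel // leq_subr.
  by rewrite /c_auto; case: eqP; rewrite ?mul1r ?mul0r.
rewrite wsumZ /c_auto; case: eqP => [cu|_]; last by rewrite !mul0r.
rewrite !mul1r -[X in wsum _ X](_ : size (drop (size u - s) u) = s); last first.
  by rewrite size_drop; lia.
rewrite wsum_pred1 /delta_auto (@drop_nth _ i (size u - s - 1)); last by lia.
have -> : (size u - s - 1).+1 = (size u - s)%N by lia.
(* The forced letters start from the end of the first copy; the overlap [cu] identifies it with the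
   letter of [u] preceding them. *)
congr chain_w; rewrite -[last i t]/(last i (i :: t)) e last_cat (last_nth i).
have -> : nth i (last i w' :: u) (size u) = nth i (drop s u) (size u - s - 1).
  by rewrite nth_drop su' /=; congr nth; lia.
by rewrite cu nth_take //; lia.
Qed.

Hypothesis P_ge0 : forall i j, 0 <= P i j.

Lemma survival_ge0 n i h : (forall j, 0 <= h j) -> 0 <= survival n i h.
Proof. by move=> h0; apply: wsum_ge0 => // t; rewrite mulr_ge0. Qed.

Lemma survival_mass_ge0 n : 0 <= survival_mass n.
Proof. by apply: sumr_ge0 => i _; apply: survival_ge0. Qed.

Lemma survival_le_mass n i : survival n i (fun _ => 1) <= survival_mass n.
Proof.
rewrite /survival_mass (bigD1 i) //= lerDl.
by apply: sumr_ge0 => j _; apply: survival_ge0.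
Qed.

Lemma first_hit_ge0 n i : 0 <= first_hit n i.
Proof.
apply: wsum_ge0 => // t; rewrite subr_ge0 ler_nat.
case: (boolP (avoids (i :: t))) => // av; have -> // : avoids (belast i t).
by move: av; rewrite lastI -cats1; apply: avoids_catl.
Qed.

(** Cutting an avoiding word at time [n], with the letter there kept on both sides, leaves two
    avoiding words. *)
Lemma survival_mass_mul n m :
  survival_mass (n + m) <= survival_mass n * survival_mass m.
Proof.
rewrite {1 2}/survival_mass mulr_suml; apply: ler_sum => i _.
rewrite /survival wsum_cat [leRHS]mulrC -wsumZ; apply: le_wsum => // t _.
rewrite mulr1; apply: le_trans (_ : (avoids (i :: t))%:R *
   survival m (last i t) (fun _ => 1) <= _); last first.
  by rewrite mulrC ler_wpM2r // survival_le_mass.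
rewrite -wsumZ; apply: le_wsum => // t' _; rewrite !mulr1 -natrM mulnb ler_nat.
case: (boolP (avoids _)) => // av.
have -> : avoids (i :: t) by move: av; rewrite -cat_cons; apply: avoids_catl.
have -> // : avoids (last i t :: t').
by move: av; rewrite -cat_cons lastI cat_rcons; apply: avoids_catr.
Qed.

Hypothesis P_stochastic : forall i, \sum_j P i j = 1.

(** This is [survivalS] with [y = 1], where stochasticity makes the one-step average of 1 equal to
    1. *)
Lemma first_hit_le_mass n i : first_hit n.+1 i <= survival_mass n.
Proof.
apply: le_trans (survival_le_mass n i).
have -> : survival n i (fun _ => 1) = survival n i (fun j => \sum_k P j k * 1).
  apply: eq_wsum => t _; congr (_ * _).
  by rewrite (eq_bigr (P (last i t))) => [|k _]; rewrite ?mulr1 ?P_stochastic.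
by rewrite survivalS mulr1 lerDr survival_ge0.
Qed.

Lemma norm_survival_le n i y :
  `|survival n i y| <= (\sum_j `|y j|) * survival_mass n.
Proof.
have ymax j : `|y j| <= \sum_j `|y j|.
  by rewrite (bigD1 j) //= lerDl sumr_ge0.
have M0 : 0 <= \sum_j `|y j| by rewrite sumr_ge0.
apply: le_trans (ler_wpM2l M0 (survival_le_mass n i)).
rewrite ler_norml -mulNr -!survivalZ; apply/andP; split; apply: le_wsum => // t _;
  by apply: ler_wpM2l => //; rewrite mulr1; have := ymax (last i t);
     rewrite ler_norml => /andP[].
Qed.

End Avoidance.

(** * Limits, submultiplicative sequences and bordered determinants *)

Lemma cvg_sum (R : realType) (T I : Type) (F : set_system T) (FF : Filter F)
    (r : seq I) (f : I -> T -> R) (l : I -> R) :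
  (forall i, f i x @[x --> F] --> l i) ->
  \sum_(i <- r) f i x @[x --> F] --> \sum_(i <- r) l i.
Proof.
by move=> fl; apply: cvg_big => [|i _]; [exact: add_continuous|exact: fl].
Qed.

Lemma cvg_sum_zero (R : realType) (I : Type) (r : seq I) (f : I -> nat -> R) :
  (forall i, f i @ \oo --> (0 : R)) ->
  (fun n => \sum_(i <- r) f i n) @ \oo --> (0 : R).
Proof. by move=> /cvg_sum f0; have := f0 r; rewrite big1_eq; apply. Qed.

(** Division of [k] by [n] bounds [e k] by a power of [e n] times one of finitely many remainder
    values. *)
Lemma submultiplicative_cvg0 (R : realType) (e : nat -> R) n :
  (forall k, 0 <= e k) -> (forall k m, e (k + m)%N <= e k * e m) ->
  (0 < n)%N -> e n < 1 -> e @ \oo --> (0 : R).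
Proof.
move=> e0 eM n0 en1; pose C := \sum_(r < n) e r.
have eX q r : e (q * n + r)%N <= e n ^+ q * e r.
  elim: q => [|q IH]; first by rewrite mul0n add0n mul1r.
  rewrite mulSn -addnA exprS -mulrA; apply: le_trans (eM _ _) _.
  exact: ler_wpM2l.
apply: (@squeeze_cvgr _ _ _ _ (fun=> 0) (fun k => C * e n ^+ (k %/ n)%N)).
- near=> k; rewrite e0 /= {1}(divn_eq k n) mulrC.
  apply: le_trans (eX _ _) _; apply: ler_wpM2l; first exact: exprn_ge0.
  have kn : (k %% n < n)%N by rewrite ltn_mod.
  by rewrite /C (bigD1 (Ordinal kn)) //= lerDl sumr_ge0.
- exact: cvg_cst.
- rewrite -[0 in X in _ --> X](mulr0 C); apply: cvgMl_tmp.
  apply: (@cvg_comp _ _ _ (fun k => (k %/ n)%N) (fun q => e n ^+ q) _ \oo).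
    move=> A [M _ MA]; exists (M * n)%N => // k /= Mk; apply: MA => /=.
    by rewrite leq_divRL.
  by apply: cvg_expr; rewrite ger0_norm.
Unshelve. all: by end_near. Qed.

(** Partial sums with different shifts are brought to one common range at the cost of a block of
    fixed length [m] near [n]. *)
Lemma sum_shift_vanishing (R : realType) (b : nat -> R) m n :
  (forall j, (j <= m)%N -> b j = 0) ->
  \sum_(k < n) b (m.+1 + k)%N = \sum_(k < n.+1) b k + \sum_(l < m) b (n.+1 + l)%N.
Proof.
move=> b0; transitivity (\sum_(j < m.+1 + n) b j).
  rewrite big_split_ord /= [X in _ = X + _]big1 ?add0r // => j _.
  by rewrite b0 // -ltnS.
have -> : (m.+1 + n = n.+1 + m)%N by lia.
by rewrite big_split_ord.
Qed.

(** Block elimination with [\adj A] gives the formula times [\det A], which cancels when nonzero.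
    Singular [A] is reached through a polynomial perturbation. *)
Lemma det_bordered (K : fieldType) n (A : 'M[K]_n) (b : 'cV[K]_n) (c : 'rV[K]_n)
    (d : 'M[K]_1) :
  \det (block_mx A b c d) = \det A * d 0 0 - (c *m \adj A *m b) 0 0.
Proof.
have nonsing (D : idomainType) (A' : 'M[D]_n) b' c' (d' : 'M[D]_1) :
    \det A' != 0 ->
    \det (block_mx A' b' c' d') = \det A' * d' 0 0 - (c' *m \adj A' *m b') 0 0.
  move=> nzA; apply: (mulIf nzA).
  have E : block_mx A' b' c' d' *m
      block_mx 1%:M (- (\adj A' *m b')) 0 (\det A')%:M =
      block_mx A' 0 c' (d' *m (\det A')%:M - c' *m \adj A' *m b').
    rewrite mulmx_block !mulmx1 !mulmx0 !addr0 !mulmxN !mulmxA mul_mx_adj.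
    by rewrite scalar_mxC addNr [in RHS]addrC.
  have := congr1 determinant E; rewrite det_mulmx det_ublock det_lblock det1.
  rewrite mul1r det_scalar1 => ->; rewrite mulrC; congr (_ * _).
  by rewrite det_mx11 mul_mx_scalar [LHS]mxE [X in X + _]mxE [X in _ + X]mxE.
(* [char_poly_mx (- A)] is [A] plus the indeterminate on the diagonal; its determinant is monic,
   hence nonzero, and evaluation at 0 returns [A]. *)
pose f := map_mx (@polyC K).
have nzX : \det (char_poly_mx (- A)) != 0 by apply: monic_neq0; exact: char_poly_monic.
pose phi : {rmorphism {poly K} -> K} := horner_eval 0.
have ev0 m p (B : 'M[K]_(m, p)) : map_mx phi (f _ _ B) = B.
  by apply/matrixP => i j; rewrite !mxE /= horner_evalE hornerC.
have evA : map_mx phi (char_poly_mx (- A)) = A.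
  apply/matrixP => i j; rewrite !mxE /= horner_evalE !hornerE raddfN opprK.
  by rewrite hornerMn hornerX mul0rn add0r.
rewrite -[in LHS]evA -[b in LHS]ev0 -[c in LHS]ev0 -[d in LHS]ev0 -map_block_mx.
rewrite det_map_mx nonsing // rmorphB rmorphM -det_map_mx evA.
congr (_ * _ - _); first by rewrite [f _ _ d 0 0]mxE /= horner_evalE hornerC.
transitivity (map_mx phi (f _ _ c *m \adj (char_poly_mx (- A)) *m f _ _ b) 0 0).
  by rewrite [RHS]mxE.
by rewrite !map_mxM map_mx_adj evA !ev0.
Qed.

(** * The bordered system and the end of the decay region *)

Section Renewal.
Variables (R : realType) (N : nat) (P : 'M[R]_N) (a : 'I_N) (v : seq 'I_N).
Local Notation u := (a :: v).
Local Notation q := (size v).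
Local Notation b := (last a v).

Hypothesis v0 : (0 < size v)%N.
Hypothesis P_ge0 : forall i j, 0 <= P i j.
Hypothesis P_stochastic : forall i, \sum_j P i j = 1.
Hypothesis delta_gt0 : 0 < delta P u.

Local Notation mass := (survival_mass P u).

Lemma tau_tildeE z :
  tau_tilde P u z = \sum_(s < size v) c_auto R u s * delta_auto P u s * z ^+ s.
Proof.
rewrite /tau_tilde /tau big_mkord big_ord_recr /= /delta_auto /=.
by rewrite subSn // subnn subSS subnn drop0 /=; ring.
Qed.

(* By [optional_stopping] and [survival_autocorrelation], the coefficient of the
   partial sum of the [first_hit] series in [y i] is the last equation of the
   system, so only the survival series and vanishing remainders are left. *)
Lemma bordered_system_survival (z : R) y c (kappa : R) i : 0 < z ->
  (fun n => mass n * z ^+ n) @ \oo --> (0 : R) ->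
  (forall j, y j = z * (\sum_k P j k * y k) + (kappa + c * (j == a)%:R)) ->
  c * tau_tilde P u z + z ^+ q * delta P u * y b = 0 ->
  (fun n => kappa * \sum_(k < n) z ^+ k * survival P u k i (fun=> 1)) @ \oo
    --> y i.
Proof.
move=> z0 mz0 yE cE; have u2 : (2 <= size u)%N by [].
pose D : R := z ^+ q * delta P u.
have D0 : D != 0 by rewrite mulf_neq0 ?expf_neq0 ?gt_eqF.
pose B k : R := z ^+ k * first_hit P u k i.
have B0 j : (j < size v)%N -> B j = 0.
  by move=> jv; rewrite /B first_hit_lt ?mulr0.
have Bcvg : B @ \oo --> (0 : R).
  rewrite -(cvg_shiftS B).
  apply: (@squeeze_cvgr _ _ _ _ (fun=> 0) (fun k => z * (mass k * z ^+ k))).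
  - near=> k; rewrite /B mulr_ge0 ?first_hit_ge0 ?exprn_ge0 ?(ltW z0) //=.
    rewrite exprS -mulrA [mass k * _]mulrC !ler_wpM2l ?exprn_ge0 ?(ltW z0) //.
    exact: first_hit_le_mass.
  - exact: cvg_cst.
  - by have := cvgMl_tmp (a := z) mz0; rewrite mulr0; apply.
pose w (s : nat) := c * (c_auto R u s * delta_auto P u s * z ^+ s).
(* The error consists of boundary blocks of the [first_hit] series, of length independent of [n],
   and of the optional stopping remainder. *)
pose err n := \sum_(s < size v) w s * (\sum_(l < (q - s).-1) B (n.+1 + l)%N) +
              D * (z ^+ n * survival P u n i y).
have errE n :
    y i - kappa * (\sum_(k < n) z ^+ k * survival P u k i (fun=> 1)) = D^-1 * err n.
  apply: (mulfI D0); rewrite mulVKf //.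
  rewrite {1}(optional_stopping u2 n i yE).
  have hE k : survival P u k i (fun j => kappa + c * (j == a)%:R) =
      kappa * survival P u k i (fun=> 1) + c * survival P u k i (fun j => (j == a)%:R).
    rewrite -!survivalZ -survivalD; apply: eq_wsum => t _.
    by rewrite mulr1.
  have -> : \sum_(k < n) z ^+ k * survival P u k i (fun j => kappa + c * (j == a)%:R)
     = kappa * (\sum_(k < n) z ^+ k * survival P u k i (fun=> 1)) +
       c * (\sum_(k < n) z ^+ k * survival P u k i (fun j => (j == a)%:R)).
    rewrite !mulr_sumr -big_split; apply: eq_bigr => k _ /=.
    by rewrite hE; ring.
  have -> : \sum_(k < n) z ^+ k.+1 * first_hit P u k.+1 i = \sum_(k < n.+1) B k.
    by rewrite [RHS]big_ord_recl B0 // add0r.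
  have -> : last i u = b by [].
  (* The autocorrelation identity is summed with weights [z ^+ (q + k)]; splitting the exponent as
     [s + (k + q - s)] turns each [s] into a shifted partial sum of [B]. *)
  have key : D * (\sum_(k < n) z ^+ k * survival P u k i (fun j => (j == a)%:R)) =
      tau_tilde P u z * (\sum_(k < n.+1) B k) +
      \sum_(s < size v) (c_auto R u s * delta_auto P u s * z ^+ s) *
         (\sum_(l < (q - s).-1) B (n.+1 + l)%N).
    rewrite tau_tildeE mulr_suml -big_split /=.
    transitivity (\sum_(s < size v) c_auto R u s * delta_auto P u s * z ^+ s *
        \sum_(k < n) B ((q - s).-1.+1 + k)%N); last first.
      apply: eq_bigr => s _; rewrite -mulrDr; congr (_ * _).
      have sv := ltn_ord s.
      rewrite (@sum_shift_vanishing _ B) // => j js; apply: B0; lia.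
    under [RHS]eq_bigr do rewrite mulr_sumr.
    rewrite exchange_big /= mulr_sumr; apply: eq_bigr => k _.
    transitivity (z ^+ q * z ^+ k *
       (delta P u * survival P u k i (fun j => (j == a)%:R))).
      by rewrite /D; ring.
    rewrite (@survival_autocorrelation _ _ _ _ u2 _ _ a v erefl) mulr_sumr.
    apply: eq_bigr => s _; have sv : (s < size v)%N := ltn_ord s.
    have -> : ((q - s).-1.+1 + k = k + q - s)%N by lia.
    rewrite /B -exprD [(q + k)%N](_ : _ = s + (k + q - s))%N; last first.
      by lia.
    by rewrite exprD /=; ring.
  rewrite /err.
  have -> : \sum_(s < size v) w s * (\sum_(l < (q - s).-1) B (n.+1 + l)%N) =
     c * \sum_(s < size v) (c_auto R u s * delta_auto P u s * z ^+ s) *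
         (\sum_(l < (q - s).-1) B (n.+1 + l)%N).
    by rewrite mulr_sumr; apply: eq_bigr => s _; rewrite /w; ring.
  have cE' : (c * tau_tilde P u z + D * y b) * (\sum_(k < n.+1) B k) = 0.
    by rewrite cE mul0r.
  move: key cE'; move: (\sum_(s < size v) _) => E1.
  set S1 := \sum_(k < n) _; set S2 := \sum_(k < n) _; set S3 := \sum_(k < n.+1) _.
  move=> key cE'.
  transitivity (c * (D * S1) + (D * y b) * S3 + D * (z ^+ n * survival P u n i y)).
    by ring.
  rewrite key; have -> : (D * y b) * S3 = - (c * tau_tilde P u z * S3).
    by apply/eqP; rewrite -addr_eq0 addrC -mulrDl cE'.
  by ring.
have errcvg : err @ \oo --> (0 : R).
  have e1 : (fun n => \sum_(s < size v) w s *
      (\sum_(l < (q - s).-1) B (n.+1 + l)%N)) @ \oo --> (0 : R).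
    apply: cvg_sum_zero => s.
    suff sl : (fun n => \sum_(l < (q - s).-1) B (n.+1 + l)%N) @ \oo --> (0 : R).
      by have := cvgMl_tmp (a := w s) sl; rewrite mulr0; apply.
    apply: cvg_sum_zero => l.
    have := Bcvg; rewrite -(cvg_shiftn l.+1 B); apply: cvg_trans.
    by apply: near_eq_cvg; near=> n => /=; rewrite addSnnS.
  have e2 : (fun n => z ^+ n * survival P u n i y) @ \oo --> (0 : R).
    apply: norm_cvg0.
    apply: (@squeeze_cvgr _ _ _ _ (fun=> 0)
       (fun k => (\sum_j `|y j|) * (mass k * z ^+ k))).
    - near=> k; rewrite normr_ge0 /= normrM ger0_norm ?exprn_ge0 ?(ltW z0) //.
      rewrite [leRHS]mulrA [leRHS]mulrC ler_wpM2l ?exprn_ge0 ?(ltW z0) //.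
      exact: norm_survival_le.
    - exact: cvg_cst.
    - by have := cvgMl_tmp (a := \sum_j `|y j|) mz0; rewrite mulr0; apply.
  by have := cvgD e1 (cvgMl_tmp (a := D) e2); rewrite mulr0 addr0; apply.
have -> : (fun n => kappa * \sum_(k < n) z ^+ k * survival P u k i (fun=> 1)) =
    (fun n => y i - D^-1 * err n).
  by apply/funext => n; rewrite -errE; ring.
have := cvgB (cvg_cst (y i)) (cvgMl_tmp (a := D^-1) errcvg).
by rewrite mulr0 subr0; apply.
Unshelve. all: by end_near. Qed.

Definition tau_poly : {poly R} :=
  \sum_(s < size v) (c_auto R u s * delta_auto P u s) *: 'X^s.

(** Taken over polynomials so that the determinant and the adjugate entries are polynomials in [z],
    hence continuous. *)
Definition bordered : 'M[{poly R}]_(N + 1) :=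
  block_mx (1%:M - 'X *: map_mx polyC P) (- delta_mx a 0)
           (((delta P u)%:P * 'X^q) *: delta_mx 0 b) tau_poly%:M.

Definition bordered_at (z : R) : 'M[R]_(N + 1) :=
  block_mx (1%:M - z *: P) (- delta_mx a 0)
           ((z ^+ q * delta P u) *: delta_mx 0 b) (tau_tilde P u z)%:M.

Lemma map_bordered z : map_mx (horner_eval z) bordered = bordered_at z.
Proof.
rewrite /bordered map_block_mx; congr block_mx; apply/matrixP => i j.
- rewrite !mxE /= horner_evalE !hornerE; congr (_ - _).
  by rewrite hornerMn hornerC.
- by rewrite !mxE /= horner_evalE hornerN hornerMn hornerC.
- by rewrite !mxE /= horner_evalE !hornerE mulrC hornerMn hornerC mulrC; ring.
- rewrite !mxE /= horner_evalE hornerMn tau_tildeE /tau_poly horner_sum.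
  by congr (_ *+ _); apply: eq_bigr => s _; rewrite !hornerE.
Qed.

Lemma det_bordered_at z : \det (bordered_at z) = f_u P u z.
Proof.
rewrite det_bordered /f_u /= mxE eqxx mulr1n mulrC; congr (_ + _).
rewrite mulmxN mxE opprK -colE -scalemxAl -rowE !mxE.
by rewrite mulrA.
Qed.

Lemma bordered_at_solve z (kappa : R) (x : 'cV[R]_(N + 1)) :
  bordered_at z *m x = col_mx (const_mx kappa) 0 ->
  (forall j, usubmx x j 0 = z * (\sum_k P j k * usubmx x k 0) +
     (kappa + dsubmx x 0 0 * (j == a)%:R)) /\
  dsubmx x 0 0 * tau_tilde P u z + z ^+ q * delta P u * usubmx x b 0 = 0.
Proof.
rewrite -{1}(vsubmxK x) mul_block_col => /eq_col_mx [E1 E2]; split.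
  move=> j; have := congr1 (fun B : 'cV[R]_N => B j 0) E1.
  have sumP : \sum_k P j k * usubmx x k 0 = (P *m usubmx x) j 0 by rewrite mxE.
  have dl : (delta_mx a (0 : 'I_1) *m dsubmx x) j 0 = dsubmx x 0 0 * (j == a)%:R.
    by rewrite mxE big_ord1 mxE eqxx andbT mulrC.
  rewrite mulmxBl mul1mx -scalemxAl mulNmx /= sumP -dl.
  move: (P *m usubmx x) (delta_mx a (0 : 'I_1) *m dsubmx x) => Px dx; rewrite !mxE => H; rewrite -H; ring.
have := congr1 (fun B : 'cV[R]_1 => B 0 0) E2.
rewrite -scalemxAl -rowE mul_scalar_mx !mxE => H.
by rewrite -{}[RHS]H; ring.
Qed.

(** The Cramer numerator for [y i] in the system with right-hand side [(1, 0)]. *)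
Definition cramer_poly i : {poly R} :=
  (\adj bordered *m col_mx (const_mx 1) 0) (lshift 1 i) (0 : 'I_1).

(** A kernel vector solves the system with [kappa = 0], so each [y j] is the limit of a zero
    sequence; the equation at [a] then forces [c = 0]. *)
Lemma f_u_neq0 (z : R) : 0 < z ->
  (fun n => mass n * z ^+ n) @ \oo --> (0 : R) -> f_u P u z != 0.
Proof.
move=> z0 mz0; rewrite -det_bordered_at -det_tr.
apply/negP => /det0P [x xn0 xK]; case/negP: xn0.
have K : bordered_at z *m x^T = col_mx (const_mx 0) 0.
  apply: trmx_inj; rewrite trmx_mul trmxK xK; apply/matrixP => i j.
  by rewrite !mxE; case: splitP => k _; rewrite mxE.
have [yE cE] := bordered_at_solve K.
have y0 j : usubmx x^T j 0 = 0.
  have cy := bordered_system_survival (i := j) z0 mz0 yE cE.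
  have c0 : (fun n => 0 * \sum_(k < n) z ^+ k * survival P u k j (fun=> 1)) @ \oo
      --> (0 : R).
    by under eq_fun do rewrite mul0r; exact: cvg_cst.
  exact: (cvg_unique _ cy c0).
have c0 : dsubmx x^T 0 0 = 0.
  have := yE a; rewrite y0 eqxx mulr1 add0r.
  rewrite big1 ?mulr0 ?add0r => [<- //|k _]; first by rewrite y0 mulr0.
rewrite -(trmxK x) -(vsubmxK x^T).
have -> : usubmx x^T = 0 by apply/matrixP => i j; rewrite ord1 y0 mxE.
have -> : dsubmx x^T = 0 by apply/matrixP => i j; rewrite !ord1 c0 mxE.
by rewrite col_mx0 trmx0.
Qed.

(** The adjugate solves the system with [kappa = f_u P u z] without any division, and partial sums
    of a nonnegative series stay below its limit. *)
Lemma cramer_bound (z : R) K : 0 < z ->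
  (fun n => mass n * z ^+ n) @ \oo --> (0 : R) ->
  `|f_u P u z| * (\sum_(k < K) z ^+ k * mass k) <= \sum_i `|(cramer_poly i).[z]|.
Proof.
move=> z0 mz0.
have -> : \sum_(k < K) z ^+ k * mass k =
    \sum_i \sum_(k < K) z ^+ k * survival P u k i (fun=> 1).
  by rewrite exchange_big; apply: eq_bigr => k _; rewrite mulr_sumr.
rewrite mulr_sumr; apply: ler_sum => i _.
pose x : 'cV[R]_(N + 1) := \adj (bordered_at z) *m col_mx (const_mx 1) 0.
have xE : bordered_at z *m x = col_mx (const_mx (f_u P u z)) 0.
  rewrite mulmxA mul_mx_adj mul_scalar_mx scale_col_mx scaler0 det_bordered_at.
  by congr col_mx; apply/matrixP => k j; rewrite !mxE mulr1.
have [yE cE] := bordered_at_solve xE.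
have cy := bordered_system_survival (i := i) z0 mz0 yE cE.
have -> : (cramer_poly i).[z] = usubmx x i 0.
  rewrite mxE /x -map_bordered -map_mx_adj.
  have -> : col_mx (const_mx 1) 0 =
      map_mx (horner_eval z) (col_mx (const_mx 1) 0) :> 'cV[R]_(N + 1).
    by apply/matrixP => k j; rewrite !mxE; case: splitP => l _;
      rewrite !mxE /= horner_evalE hornerC.
  by rewrite -map_mxM [RHS]mxE.
apply: (cvgr_to_ge (cvg_norm cy)).
exists K => // n /= Kn; rewrite normrM ler_wpM2l //.
have pos k : 0 <= z ^+ k * survival P u k i (fun=> 1).
  by rewrite mulr_ge0 ?exprn_ge0 ?(ltW z0) ?survival_ge0.
rewrite ger0_norm ?sumr_ge0 //.
by rewrite -(subnKC Kn) big_split_ord /= lerDl sumr_ge0.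
Qed.

Lemma mass_submul (z : R) : 0 < z -> forall k m,
  mass (k + m) * z ^+ (k + m) <= mass k * z ^+ k * (mass m * z ^+ m).
Proof.
move=> z0 k m; rewrite exprD mulrACA ler_wpM2r ?mulr_ge0 ?exprn_ge0 ?(ltW z0) //.
exact: survival_mass_mul.
Qed.

Lemma mass_cvg0 (z : R) n : 0 < z -> (0 < n)%N -> mass n * z ^+ n < 1 ->
  (fun n => mass n * z ^+ n) @ \oo --> (0 : R).
Proof.
move=> z0 n0 h; apply: (submultiplicative_cvg0 _ (mass_submul z0) n0 h) => k.
by rewrite mulr_ge0 ?exprn_ge0 ?(ltW z0) ?survival_mass_ge0.
Qed.

(** A single value below 1 would force decay by submultiplicativity, which excludes a root. *)
Lemma mass_ge1_at_root (z : R) n : 0 < z -> f_u P u z = 0 -> (0 < n)%N ->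
  1 <= mass n * z ^+ n.
Proof.
move=> z0 fz n0; rewrite leNgt; apply/negP => h.
by have := f_u_neq0 z0 (mass_cvg0 z0 n0 h); rewrite fz eqxx.
Qed.

(* The supremum [zeta] of the decay region is a root of [f_u]: otherwise
   [cramer_bound] would bound the partial sums of [mass k * zeta ^+ k] although
   each of their terms is at least [1]. *)
Lemma mass_lt1_below_root (z0 z : R) :
  (forall x, 0 < x < z0 -> f_u P u x != 0) -> 0 < z < z0 ->
  exists2 n, (0 < n)%N & mass n * z ^+ n < 1.
Proof.
move=> froot /andP[z_gt0 zz0]; apply: contrapT => nz.
pose E := [set x : R | 0 < x /\ exists2 n, (0 < n)%N & mass n * x ^+ n < 1].
have zE x : E x -> x <= z.
  move=> [x0 [n n0 xn]]; rewrite leNgt; apply/negP => zx; apply: nz; exists n => //.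
  apply: le_lt_trans xn; rewrite ler_wpM2l ?survival_mass_ge0 //.
  by rewrite lerXn2r ?nnegrE ?(ltW z_gt0) ?(ltW x0) ?(ltW zx).
have m1 : 0 < 1 + mass 1 by rewrite ltr_pwDl // survival_mass_ge0.
(* Here the exponent [n = 1] already suffices. *)
have E0 : E (1 + mass 1)^-1.
  split; first by rewrite invr_gt0.
  by exists 1%N => //; rewrite expr1 ltr_pdivrMr // mul1r ltrDr.
have Eub : has_ubound E by exists z => x /zE.
pose zeta := sup E.
have zeta_gt0 : 0 < zeta.
  by apply: lt_le_trans (ub_le_sup Eub E0); rewrite invr_gt0.
have zeta_le : zeta <= z by apply: ge_sup => //; exists (1 + mass 1)^-1.
have below x : 0 < x -> x < zeta -> E x.
  move=> x0 xz; have zx : 0 < zeta - x by rewrite subr_gt0.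
  have Esup : has_sup E by split => //; exists (1 + mass 1)^-1.
  have [y [y0 [n n0 yn]]] := sup_adherent zx Esup.
  rewrite -/zeta subKr => xy; split => //; exists n => //; apply: le_lt_trans yn.
  rewrite ler_wpM2l ?survival_mass_ge0 //.
  by rewrite lerXn2r ?nnegrE ?(ltW x0) ?(ltW y0) ?(ltW xy).
(* A strict inequality at [zeta] would persist slightly to its right by continuity, beyond the
   supremum. *)
have at_zeta n : (0 < n)%N -> 1 <= mass n * zeta ^+ n.
  move=> n0; rewrite leNgt; apply/negP => zn.
  have ctn : (fun x : R => mass n * x ^+ n) x @[x --> zeta^'+] --> mass n * zeta ^+ n.
    apply: cvg_at_right_filter; apply: cvgMl_tmp; exact: exprn_continuous.
  have [x [xz xn]] : exists x, zeta < x /\ mass n * x ^+ n < 1.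
    near (zeta^'+)%R => x; exists x; split; first by near: x; exact: nbhs_right_gt.
    by near: x; exact: (cvgr_lt _ ctn).
  have : x <= zeta.
    by apply: (ub_le_sup Eub); split; [exact: lt_trans xz|exists n].
  by rewrite leNgt xz.
have fz : f_u P u zeta != 0.
  by apply: froot; rewrite zeta_gt0 (le_lt_trans zeta_le).
pose g (x : R) := \sum_i `|(cramer_poly i).[x]|.
(* [cramer_bound] applies only inside the decay region; both sides are continuous, so it passes to
   the limit from the left. *)
have bound K : `|f_u P u zeta| * (\sum_(k < K) zeta ^+ k * mass k) <= g zeta.
  rewrite -subr_ge0.
  pose h x := g x - `|f_u P u x| * (\sum_(k < K) x ^+ k * mass k).
  have hc : h x @[x --> zeta^'-] --> h zeta.
    apply: cvg_at_left_filter; apply: cvgB.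
      apply: cvg_sum => i; apply: cvg_norm; exact: continuous_horner.
    apply: cvgM.
      apply: cvg_norm.
      under eq_cvg do rewrite -det_bordered_at -map_bordered det_map_mx.
      rewrite -det_bordered_at -map_bordered det_map_mx; exact: continuous_horner.
    by apply: cvg_sum => k; apply: cvgMr_tmp; exact: exprn_continuous.
  apply: (cvgr_to_ge hc); near=> x; rewrite subr_ge0.
  have x0 : 0 < x by near: x; exact: nbhs_left_gt.
  have [_ [n n0 xn]] : E x by apply: below => //; near: x; exact: nbhs_left_lt.
  exact: cramer_bound (mass_cvg0 x0 n0 xn).
pose f := `|f_u P u zeta|.
have f0 : 0 < f by rewrite normr_gt0.
have g0 : 0 <= g zeta / f by rewrite divr_ge0 ?sumr_ge0 // ltW.
(* One extra term is taken because [at_zeta] says nothing about [k = 0], whose term is only bounded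
   below by 0. *)
have := bound (Num.bound (g zeta / f)).+1; rewrite leNgt => /negP; apply.
rewrite mulrC -ltr_pdivrMr //; apply: lt_le_trans (archi_boundP g0) _.
rewrite big_ord_recl -[leLHS]add0r lerD ?mulr_ge0 ?survival_mass_ge0 //.
rewrite -[leLHS]mulr1 mulr_natl -[in leLHS](card_ord (Num.bound (g zeta / f))).
rewrite -sumr_const; apply: ler_sum => k _; rewrite mulrC; exact: at_zeta.
Unshelve. all: by end_near. Qed.

End Renewal.

(** * The Markov measure in terms of survival sums *)

Section MarkovMeasure.
Variables (R : realType) (N : nat) (A : 'M[bool]_N) (P : 'M[R]_N) (p : 'I_N -> R).

Lemma chain_w_gt0 d a v :
  (forall i, (i < size v)%N -> 0 < P (nth d (a :: v) i) (nth d v i)) ->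
  0 < chain_w P a v.
Proof.
elim: v a => [|b v IH] a Pv //=; apply: mulr_gt0; first exact: (Pv 0%N).
by apply: IH => i iv; exact: (Pv i.+1).
Qed.

Lemma allowed_delta_gt0 u : (forall i j, (0 < P i j) = A i j) ->
  allowed A u -> 0 < delta P u.
Proof.
case: u => [|a v] PA [x [xA [k xu]]]; first exact: ltr01.
apply: (@chain_w_gt0 (x k)) => i iv; rewrite PA.
rewrite -xu; last exact: ltnW.
have := xu i.+1; rewrite /= ltnS => /(_ iv) <-.
by rewrite addnS.
Qed.

(** Some state has positive mass, and stationarity carries positivity along the paths given by
    irreducibility. *)
Lemma stationary_gt0 : irreducible01 A ->
  (forall i j, 0 <= P i j) -> (forall i j, (0 < P i j) = A i j) ->
  (forall i, 0 <= p i) -> \sum_i p i = 1 ->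
  (forall j, \sum_i p i * P i j = p j) -> forall j, 0 < p j.
Proof.
move=> irr P0 PA p0 p1 pP j.
have [i pi0] : exists i, 0 < p i.
  apply: contrapT => np; have : \sum_i p i = 0.
    apply: big1 => i _; apply/eqP; rewrite eq_le p0 andbT leNgt.
    by apply/negP => pi0; apply: np; exists i.
  by rewrite p1 => /eqP; rewrite oner_eq0.
have [s [_ [sp <-]]] := irr i j.
elim: s i pi0 sp => [|k s IH] i pi0 //= /andP[ik ks]; apply: IH ks.
rewrite -pP (bigD1 i) //=; apply: ltr_pwDl; first by rewrite mulr_gt0 // PA.
by apply: sumr_ge0 => l _; rewrite mulr_ge0.
Qed.

Lemma sum_muC n k (Q : pred (seq 'I_N)) : n = k.+1 ->
  \sum_(w : n.-tuple 'I_N | Q w) muC p P w =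
  \sum_i p i * wsum P k i (fun t => (Q (i :: t))%:R).
Proof.
move=> ->; rewrite big_mkcond /=.
rewrite (sum_tuple_cons _ (fun w => if Q w then muC p P w else 0)).
apply: eq_bigr => i _; rewrite wsum_tuple mulr_sumr; apply: eq_bigr => t _ /=.
by case: (Q _); rewrite ?mulr1 ?mulr0.
Qed.

(** In a word of [m + size u] letters an occurrence of [u] must start at a position at most [m], so
    the condition on positions is plain avoidance. *)
Lemma muW_survival a v m :
  muW p P (a :: v) m =
  \sum_i p i * survival P (a :: v) (m + size v) i (fun=> 1).
Proof.
set u := a :: v.
have -> : muW p P u m =
    \sum_(w : (m + size u).-tuple 'I_N | avoids u w) muC p P w.
  apply: eq_bigl => w; apply/idP/idP.
    move/forallP => av; apply/negP => /infixP [s1 [s2 wE]].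
    have s1m : (size s1 < m.+1)%N.
      have := size_tuple w; rewrite wE !size_cat addnCA addnC => /addIn <-.
      by rewrite ltnS leq_addr.
    have := av (Ordinal s1m); rewrite /= wE drop_size_cat // take_size_cat //.
    by rewrite eqxx.
  move=> av; apply/forallP => i; apply: contra av => /eqP wE.
  by rewrite -{1}wE; apply: infix_trans (infix_drop _ i); exact: infix_take.
rewrite (sum_muC _ (addnS m (size v))); apply: eq_bigr => i _; congr (_ * _).
by apply: eq_wsum => t _; rewrite mulr1.
Qed.

End MarkovMeasure.

(** * The escape rate *)

Theorem theorem4p10 (R : realType) (N : nat) (A : 'M[bool]_N) (P : 'M[R]_N)
    (p : 'I_N -> R) (u : seq 'I_N) (z0 : R) :
  irreducible01 A ->
  (forall i j, 0 <= P i j) ->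
  (forall i, \sum_j P i j = 1) ->
  (forall i j, (0 < P i j) = A i j) ->
  (forall i, 0 <= p i) -> \sum_i p i = 1 ->
  (forall j, \sum_i p i * P i j = p j) ->
  allowed A u -> (2 <= size u)%N ->
  0 < z0 -> f_u P u z0 = 0 ->
  (forall z, 0 < z < z0 -> f_u P u z != 0) ->
  (fun m : nat => - (ln (muW p P u m) / m%:R)) @ \oo --> ln z0.
Proof.
move=> irr P0 P1 PA p0 p1 pP au u2 z0_gt0 fz0 fz.
have d0 := allowed_delta_gt0 PA au.
have pgt := stationary_gt0 irr P0 PA p0 p1 pP.
case: u u2 fz0 fz d0 {au} => [|a v] // u2 fz0 fz d0.
have v0 : (0 < size v)%N by [].
set u := a :: v in u2 fz0 fz d0 *.
pose mass := survival_mass P u.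
have ple1 i : p i <= 1 by rewrite -p1 (bigD1 i) //= lerDl sumr_ge0.
(* A uniform positive lower bound: a product of numbers in (0, 1] is at most each factor. *)
pose c := \prod_i p i.
have c0 : 0 < c by apply: prodr_gt0 => i _.
have cp i : c <= p i.
  rewrite /c (bigD1 i) //= ler_piMr //; apply: prodr_ile1 => j _.
  by rewrite p0 ple1.
have muW_le m : muW p P u m <= mass (m + size v)%N.
  rewrite muW_survival; apply: ler_sum => i _.
  by rewrite ler_piMl // survival_ge0.
have muW_ge m : c * mass (m + size v)%N <= muW p P u m.
  rewrite muW_survival mulr_sumr; apply: ler_sum => i _.
  by rewrite ler_wpM2r // survival_ge0.
(* Half of [e] pays for moving from [z0] into the decay region; the other half absorbs the constants
   in [mK]. *)
apply/cvgrPdist_lt => e e0; pose z := z0 * expR (- (e / 2)).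
have z_gt0 : 0 < z by rewrite mulr_gt0 ?expR_gt0.
have zz0 : z < z0.
  by rewrite /z gtr_pMr // expR_lt1; lra.
have lnz : ln z = ln z0 - e / 2 by rewrite lnM ?posrE ?expR_gt0 // expRK.
have [n n0 nlt] := mass_lt1_below_root v0 P0 P1 d0 fz
  (introT andP (conj z_gt0 zz0)).
have mcvg := mass_cvg0 P0 z_gt0 n0 nlt.
have := mcvg; rewrite -(cvg_shiftn (size v)) => mcvg'.
near=> m.
have m_gt0 : (0 < m)%N by near: m; exact: nbhs_infty_gt.
have mR : 0 < m%:R :> R by rewrite ltr0n.
have mlt : mass (m + size v)%N * z ^+ (m + size v) < 1.
  by near: m; apply: (cvgr_lt _ mcvg').
have mge : 1 <= mass (m + size v)%N * z0 ^+ (m + size v).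
  by apply: mass_ge1_at_root => //; rewrite addn_gt0 m_gt0.
have mass_gt0 : 0 < mass (m + size v)%N.
  by move: (lt_le_trans ltr01 mge); rewrite pmulr_lgt0 // exprn_gt0.
have muW0 : 0 < muW p P u m by apply: lt_le_trans (muW_ge m); rewrite mulr_gt0.
have up : ln (muW p P u m) <= - ((m%:R + (size v)%:R) * ln z).
  apply: le_trans (_ : ln (mass (m + size v)%N) <= _).
    by rewrite ler_ln ?posrE.
  have := ln_le0 (ltW mlt); rewrite lnM ?posrE ?exprn_gt0 // lnXn // -[ln _ *+ _]mulr_natl.
  by rewrite natrD; lra.
have lo : ln c - (m%:R + (size v)%:R) * ln z0 <= ln (muW p P u m).
  apply: le_trans (_ : ln (c * mass (m + size v)%N) <= _); last first.
    by rewrite ler_ln ?posrE // mulr_gt0.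
  rewrite lnM ?posrE //.
  have := ln_ge0 mge; rewrite lnM ?posrE ?exprn_gt0 // lnXn // -[ln _ *+ _]mulr_natl.
  by rewrite natrD; lra.
(* The terms that do not grow with [m] come from the shift by [size v] and from [c]. *)
have mK : `|(size v)%:R * ln z| + `|(size v)%:R * ln z0 - ln c| < e / 2 * m%:R.
  rewrite -ltr_pdivrMl ?divr_gt0 //; near: m; exact: nbhs_infty_gtr.
have k1 := ler_norm ((size v)%:R * ln z).
have k1' := ler_norm (- ((size v)%:R * ln z)).
have k2 := ler_norm ((size v)%:R * ln z0 - ln c).
have k2' := normr_ge0 ((size v)%:R * ln z0 - ln c).
rewrite normrN in k1'.
rewrite lnz in up k1 k1' mK; rewrite opprK ltr_norml.
have muE : ln (muW p P u m) = ln (muW p P u m) / m%:R * m%:R.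
  by rewrite divfK ?gt_eqF.
move: (_ / _) muE => x muE; rewrite muE in up lo.
by rewrite -(ltr_pM2r mR) -[X in _ && X](ltr_pM2r mR); apply/andP; split; lra.
Unshelve. all: by end_near. Qed.
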